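(* Let $\mathcal A=\mathcal B\oplus\mathcal I$ be a commutative Banach algebra that is the semidirect product of a semisimple closed subalgebra $\mathcal B$ and a semisimple closed ideal $\mathcal I$, such that $\langle\mathcal I\mathcal B\rangle=\mathcal I$. If $\mathcal A$ is a BSE-algebra, then $\mathcal B$ is a BSE-algebra.
   Context: A Banach algebra $\mathcal A$ is a semidirect product of a closed subalgebra $\mathcal B$ and a closed two-sided ideal $\mathcal I$ of $\mathcal A$ if $\mathcal A=\mathcal B\oplus\mathcal I$ (direct sum of vector spaces). Writing elements as pairs $(b,a)$ with $b\in\mathcal B$, $a\in\mathcal I$ (representing $b+a$), the product is $(b,a)(b',a')=(bb',\,aa'+ba'+ab')$ and the norm is $\|(b,a)\|=\|b\|+\|a\|$. $\langle\mathcal I\mathcal B\rangle$ denotes the closed linear span of $\{ab:a\in\mathcal I,\ b\in\mathcal B\}$. For a commutative Banach algebra $\mathcal C$, $\Delta(\mathcal C)$ is its carrier space (nonzero multiplicative linear functionals, with the Gelfand topology), and $\mathcal C$ is without order if $c\,\mathcal C=\{0\}$ implies $c=0$ (commutative semisimple algebras are without order). $C_{BSE}(\Delta(\mathcal C))$ is the set of continuous complex-valued functions $\sigma$ on $\Delta(\mathcal C)$ for which there is a constant $C>0$ with $\left|\sum_{j=1}^n c_j\sigma(\varphi_j)\right|\le C\left\|\sum_{j=1}^n c_j\varphi_j\right\|_{\mathcal C^*}$ for all $n$, all $\varphi_1,\dots,\varphi_n\in\Delta(\mathcal C)$ and all $c_1,\dots,c_n\in\mathbb C$. $M(\mathcal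 C)$ is the set of multipliers, i.e. linear operators $T$ on $\mathcal C$ with $cT(b)=T(c)b$ for all $b,c\in\mathcal C$; for $T\in M(\mathcal C)$, $\widehat T$ is the unique continuous function on $\Delta(\mathcal C)$ with $\varphi(T(c))=\widehat T(\varphi)\varphi(c)$ for all $c\in\mathcal C$, $\varphi\in\Delta(\mathcal C)$, and $\widehat{M(\mathcal C)}=\{\widehat T:T\in M(\mathcal C)\}$. A commutative Banach algebra $\mathcal C$ without order is a BSE-algebra if $C_{BSE}(\Delta(\mathcal C))=\widehat{M(\mathcal C)}$. *)

(* Defs.v *)
From HB Require Import structures.
From mathcomp Require Import all_boot all_order all_algebra.
From mathcomp Require Import all_classical all_reals.
From mathcomp Require Import ereal topology normedtype.
From mathcomp Require Import complex.

Set Implicit Arguments.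
Unset Strict Implicit.
Unset Printing Implicit Defensive.

Import Order.TTheory GRing.Theory Num.Theory.
Import numFieldNormedType.Exports.

Local Open Scope classical_set_scope.
Local Open Scope ring_scope.

Declare Scope banach_scope.
Delimit Scope banach_scope with B.
Local Open Scope banach_scope.

(* The algebras are not assumed to have a unit, so the product cannot be the
   one of the MathComp ring structures. *)
HB.mixin Record CompleteNormedModule_isComBanachAlgebra (K : numFieldType) A
    & CompleteNormedModule K A := {
  bmul : A -> A -> A;
  bmulA : associative bmul;
  bmulC : commutative bmul;
  bmulDl : left_distributive bmul +%R;
  bmulZl : forall (k : K) (x y : A), bmul (k *: x) y = k *: bmul x y;
  ler_norm_bmul : forall x y : A, `|bmul x y| <= `|x| * `|y|
}.

#[short(type="comBanachAlgType")]
HB.structure Definition ComBanachAlgebra (K : numFieldType) :=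
  {A of CompleteNormedModule K A
      & CompleteNormedModule_isComBanachAlgebra K A}.

Notation "x ** y" := (bmul x y) (at level 40, left associativity) : banach_scope.

Section ClosedSubalgebra.
Context {K : numFieldType} {A : comBanachAlgType K}.

Record closed_subalgebra := ClosedSubalgebra {
  subalg_set :> set A;
  subalg0 : subalg_set 0;
  subalgD : forall x y, subalg_set x -> subalg_set y -> subalg_set (x + y);
  subalgZ : forall (k : K) x, subalg_set x -> subalg_set (k *: x);
  subalgM : forall x y, subalg_set x -> subalg_set y -> subalg_set (x ** y);
  subalg_closed : closed subalg_set
}.

Variable B : closed_subalgebra.

Definition subalg_pred : {pred A} := fun x => x \in subalg_set B.

Fact subalg_submod_closed : submod_closed subalg_pred.
Proof.
split=> [|k x y /set_mem Bx /set_mem By]; apply/mem_set; first exact: subalg0.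
by apply: subalgD => //; exact: subalgZ.
Qed.

HB.instance Definition _ :=
  GRing.isSubmodClosed.Build K A subalg_pred subalg_submod_closed.

(* The carrier of B, made below into a Banach algebra for the norm of A. *)
Record subalg : Type :=
  Subalg { subalg_val : A; subalg_valP : subalg_val \in subalg_pred }.

HB.instance Definition _ := [isSub for subalg_val].
HB.instance Definition _ := [Choice of subalg by <:].
HB.instance Definition _ := [SubChoice_isSubZmodule of subalg by <:].
HB.instance Definition _ := [SubZmodule_isSubLmodule of subalg by <:].

Let sub_norm (x : subalg) : K := `|val x|.

Fact subalg_ler_normD x y : sub_norm (x + y) <= sub_norm x + sub_norm y.
Proof. exact: ler_normD. Qed.

Fact subalg_normrZ k x : sub_norm (k *: x) = `|k| * sub_norm x.
Proof. exact: normrZ. Qed.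

Fact subalg_normr0_eq0 x : sub_norm x = 0 -> x = 0.
Proof. by move/normr0_eq0 => x0; apply/val_inj; rewrite x0. Qed.

HB.instance Definition _ := Lmodule_isNormed.Build K subalg
  subalg_ler_normD subalg_normrZ subalg_normr0_eq0.

Lemma subalg_normE (x : subalg) : `|x| = `|val x|.
Proof. by []. Qed.

Fact subalg_complete (F : set_system subalg) :
  ProperFilter F -> cauchy F -> cvg F.
Proof.
move=> FF cF.
have cA : cauchy (val @ F : set_system A).
  apply/cauchy_ballP => e e0.
  have /cauchy_ballP/(_ e e0)[[P Q] [FP FQ] PQ] := cF.
  exists (val @` P, val @` Q).
    by split => /=; [apply: filterS FP|apply: filterS FQ] => x; exists x.
  move=> _ [[x Px <-] [y Qy <-]] /=; have := PQ (x, y) (conj Px Qy).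
  by rewrite -(@ball_normE K subalg) -(@ball_normE K A).
have /cvg_ex[l Fl] : cvg (val @ F : set_system A).
  exact: cauchy_cvg cA.
have Bl : subalg_set B l.
  apply: (closed_cvg _ (@subalg_closed B) _ _ Fl).
  by apply: nearW => x; exact: set_mem (valP x).
apply/cvg_ex; exists (Subalg (mem_set Bl)); apply/cvgrPdist_lt => e e0.
by have /cvgrPdist_lt/(_ e e0) := Fl.
Qed.

HB.instance Definition _ := Uniform_isComplete.Build subalg subalg_complete.

Definition subalg_mul (x y : subalg) : subalg :=
  Subalg (mem_set (subalgM (set_mem (valP x)) (set_mem (valP y)))).

Fact subalg_mulA : associative subalg_mul.
Proof. by move=> x y z; apply/val_inj/bmulA. Qed.

Fact subalg_mulC : commutative subalg_mul.
Proof. by move=> x y; apply/val_inj/bmulC. Qed.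

Fact subalg_mulDl : left_distributive subalg_mul +%R.
Proof. by move=> x y z; apply/val_inj/bmulDl. Qed.

Fact subalg_mulZl (k : K) (x y : subalg) :
  subalg_mul (k *: x) y = k *: subalg_mul x y.
Proof. exact/val_inj/bmulZl. Qed.

Fact subalg_ler_norm_mul (x y : subalg) : `|subalg_mul x y| <= `|x| * `|y|.
Proof. exact: ler_norm_bmul. Qed.

HB.instance Definition _ :=
  CompleteNormedModule_isComBanachAlgebra.Build K subalg
    subalg_mulA subalg_mulC subalg_mulDl subalg_mulZl subalg_ler_norm_mul.

End ClosedSubalgebra.
Arguments closed_subalgebra {K} A.

Section Characters.
Context {K : numFieldType} (A : comBanachAlgType K).

Record character := Character {
  character_fun :> {scalar A};
  characterM : forall x y : A,
    character_fun (x ** y) = character_fun x * character_fun y;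
  character_neq0 : exists x : A, character_fun x != 0
}.

HB.instance Definition _ := gen_eqMixin character.
HB.instance Definition _ := gen_choiceMixin character.
(* Gelfand topology: pointwise convergence on A. *)
HB.instance Definition _ := Topological.copy character
  (initial_topology (fun phi : character => (phi : A -> K) : {ptws A -> K})).

End Characters.

Section Radical.
Context {K : numFieldType} (A : comBanachAlgType K).

Definition without_order :=
  forall c : A, (forall x : A, c ** x = 0) -> c = 0.

(* For a commutative Banach algebra this is the Jacobson radical. *)
Definition radical : set A :=
  [set x | forall phi : character A, phi x = 0].

Definition semisimple := radical = [set 0].

Definition multipliers : set {linear A -> A} :=
  [set T | forall b c : A, c ** T b = T c ** b].

Definition is_multiplier_transform (T : {linear A -> A}) (s : character A -> K) :=
  continuous s /\ forall (phi : character A) (c : A), phi (T c) = s phi * phi c.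

Lemma character_eval_continuous (c : A) :
  continuous (fun phi : character A => phi c).
Proof.
move=> phi.
apply: (@continuous_comp (character A) {ptws A -> K} K
  (fun psi : character A => (psi : A -> K) : {ptws A -> K}) (fun f => f c)).
  exact: (@initial_continuous (character A) {ptws A -> K}).
exact: (@proj_continuous A (fun=> K) c).
Qed.

(* Every multiplier has a transform, and only one. *)
Lemma multiplier_transformP (T : {linear A -> A}) :
  multipliers T -> exists! s, is_multiplier_transform T s.
Proof.
move=> MT; have nz (phi : character A) := projT2 (cid (character_neq0 phi)).
set e := fun phi : character A => projT1 (cid (character_neq0 phi)) in nz.
have key (phi : character A) b c : phi (T c) * phi b = phi (T b) * phi c.
  by rewrite -!characterM -MT bmulC.
pose s (phi : character A) := phi (T (e phi)) / phi (e phi).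
have sE (phi : character A) b : phi b != 0 -> s phi = phi (T b) / phi b.
  by move=> b0; apply/eqP; rewrite eqr_div ?nz// key.
exists s; split=> [|s' [_ s'P]]; last first.
  by apply/funext => phi; rewrite /s s'P mulfK ?nz.
split=> [phi|phi c]; last first.
  by rewrite /s mulrAC -key mulfK ?nz.
set c := e phi; have c0 : phi c != 0 := nz phi.
have ec := @character_eval_continuous c phi.
have near_s : nbhs phi [set psi : character A | psi (T c) / psi c = s psi].
  have cnz : nbhs phi [set psi : character A | psi c != 0].
    exact: cvgr_neq0 _ ec c0.
  by apply: filterS cnz => psi /= pc; rewrite (sE psi c).
apply: (cvg_trans (near_eq_cvg near_s)).
rewrite /continuous_at (sE phi c c0); apply: cvgM.
  exact: character_eval_continuous.
by apply: cvgV; [exact: c0|exact: ec].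
Qed.

Definition multiplier_transforms : set (character A -> K) :=
  [set s | exists2 T, multipliers T & is_multiplier_transform T s].

End Radical.
Arguments multipliers {K} A _.
Arguments multiplier_transforms {K} A _.

Section BSE.
Context {R : realType}.
Let C : numFieldType := R[i].
Variable (A : comBanachAlgType C).

(* The norms of C and A take their values in C; [modulus] is real-valued. *)
Definition modulus (z : C) : R := complex.Re `|z|.

(* [+oo] when f is unbounded on the unit ball, which does not happen for
   linear combinations of characters. *)
Definition dual_norm (f : A -> C) : \bar R :=
  ereal_sup [set (modulus (f x))%:E | x in [set x : A | `|x| <= 1]].

Definition C_BSE : set (character A -> C) :=
  [set s : character A -> C | continuous s /\
    exists2 M : R, 0 < M &
      forall (n : nat) (c : 'I_n -> C) (phi : 'I_n -> character A),
        ((modulus (\sum_(j < n) c j * s (phi j))%R)%:E <=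
         M%:E * dual_norm (fun x => \sum_(j < n) c j * phi j x)%R)%E].

Definition BSE_algebra :=
  without_order A /\ C_BSE = multiplier_transforms A.

End BSE.
Arguments C_BSE {R} A _.

Section SemidirectProduct.
Context {K : numFieldType} {A : comBanachAlgType K}.

Definition two_sided_ideal (I : set A) :=
  forall x a : A, I a -> I (x ** a) /\ I (a ** x).

(* The norm b + a |-> |b| + |a| is not imposed: the norm of A is equivalent to it
   by the open mapping theorem, and being BSE depends on the norm only up to
   equivalence. *)
Definition semidirect_product (B I : closed_subalgebra A) :=
  [/\ two_sided_ideal I,
      [set b + a | b in (B : set A) & a in (I : set A)] = setT &
      (B `&` I : set A) = [set 0]].

Definition linear_span (S : set A) : set A :=
  [set x | exists n (k : 'I_n -> K) (v : 'I_n -> A),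
    (forall j, S (v j)) /\ x = \sum_(j < n) k j *: v j].

Definition closed_span_mul (I B : set A) : set A :=
  closure (linear_span [set a ** b | a in I & b in B]).

End SemidirectProduct.

(* Main.v *)
From HB Require Import structures.
Require Import Defs.
From mathcomp Require Import all_boot all_order all_algebra.
From mathcomp Require Import all_classical all_reals.
From mathcomp Require Import ereal topology normedtype sequences.
From mathcomp Require Import complex ring lra.

(** Write [A = B + I] and let [p : A -> B] be the projection along the ideal
    [I]; it is an algebra morphism with [p b = b] on [B].  Characters travel
    both ways: a character [psi] of [B] lifts to [psi \o p], and a character of
    [A] restricts to [B].  The restriction is never zero: a character killing
    [B] kills the products [a ** b], hence, being continuous
    ([character_contractive]), their closed span [I], hence [A]
    ([character_restriction_neq0]).

    Let [s] be a BSE function on the characters of [B].  Composing it with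
    restriction gives a BSE function on those of [A], with the same constant,
    because [B] carries the norm of [A].  It is therefore the transform of a
    multiplier [T] of [A], and [b |-> p (T b)] is a multiplier of [B] with
    transform [s] ([C_BSE_sub_retract]).

    Conversely, let [s] be the transform of a multiplier [S] of [B].  The
    identity of [A] is a multiplier with transform [1], so that
    [|sum_j d_j| <= M |sum_j d_j phi_j|] for all characters [phi_j] of [A]
    ([identity_C_BSE]).  For [d_j = c_j s(psi_j)] and [phi_j = psi_j \o p] the
    functional on the right is [f \o S \o p], where [f = sum_j c_j psi_j].  It
    remains to bound its norm by a multiple of that of [f].  This would follow
    from the continuity of [S] and [p], but the closed graph theorem can be
    bypassed: when [f] runs over the combinations of characters of norm at most
    [1], the functionals [f \o S \o p] are bounded, being themselves
    combinations of characters, and at each [x] they are bounded by the norm of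
    [S (p x)]; so the uniform boundedness principle applies
    ([multiplier_transforms_sub_quotient]). *)

Set Implicit Arguments.
Unset Strict Implicit.
Unset Printing Implicit Defensive.

Import Order.TTheory GRing.Theory Num.Theory.
Import numFieldNormedType.Exports.

Local Open Scope classical_set_scope.
Local Open Scope ring_scope.
Local Open Scope complex_scope.
Local Open Scope banach_scope.

(** * Real-valued norms *)

Section RealNorm.
Context {R : realType} {V : normedModType R[i]}.

(** The norms take their values in [R[i]], which is only partially ordered; the
    estimates are made in [R], where any two bounds can be compared. *)
Definition rnorm (x : V) : R := complex.Re `|x|.

Lemma normE (x : V) : `|x| = (rnorm x)%:C.
Proof. by rewrite /rnorm RRe_real ?normr_real. Qed.

Lemma rnorm_ge0 x : 0 <= rnorm x.
Proof. by rewrite -ler0c -normE. Qed.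

Lemma rnormD x y : rnorm (x + y) <= rnorm x + rnorm y.
Proof. by rewrite -lecR rmorphD /= -!normE ler_normD. Qed.

Lemma rnormN x : rnorm (- x) = rnorm x.
Proof. by rewrite /rnorm normrN. Qed.

Lemma rdistC x y : rnorm (x - y) = rnorm (y - x).
Proof. by rewrite /rnorm distrC. Qed.

Lemma rnormZ (k : R[i]) x : rnorm (k *: x) = modulus k * rnorm x.
Proof.
by apply: (fmorph_inj (real_complex R)); rewrite rmorphM /= -!normE normrZ
  /modulus RRe_real ?normr_real.
Qed.

Lemma rnorm0 : rnorm 0 = 0.
Proof. by rewrite /rnorm normr0. Qed.

Lemma rnorm_eq0 x : rnorm x = 0 -> x = 0.
Proof. by move=> x0; apply/normr0_eq0; rewrite normE x0. Qed.

Lemma norm_leE x (r : R) : (`|x| <= r%:C) = (rnorm x <= r).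
Proof. by rewrite normE lecR. Qed.

End RealNorm.

Section Modulus.
Context {R : realType}.
Implicit Types z w : R[i].

Lemma modulus_ge0 z : 0 <= modulus z.
Proof. exact: (@rnorm_ge0 R R[i]^o). Qed.

Lemma modulus0 : modulus 0 = 0 :> R.
Proof. exact: (@rnorm0 R R[i]^o). Qed.

Lemma modulusD z w : modulus (z + w) <= modulus z + modulus w.
Proof. exact: (@rnormD R R[i]^o). Qed.

Lemma modulusM z w : modulus (z * w) = modulus z * modulus w.
Proof. exact: (@rnormZ R R[i]^o). Qed.

Lemma modulus_eq0 z : modulus z = 0 -> z = 0.
Proof. exact: (@rnorm_eq0 R R[i]^o). Qed.

Lemma modulus_real (r : R) : 0 <= r -> modulus r%:C = r.
Proof. by move=> r0; rewrite /modulus ger0_norm ?ler0c. Qed.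

Lemma modulus_sum n (F : 'I_n -> R[i]) :
  modulus (\sum_(j < n) F j) <= \sum_(j < n) modulus (F j).
Proof.
elim/big_ind2: _ => [|x a y b xa yb|//]; first by rewrite modulus0.
by rewrite (le_trans (modulusD _ _))// lerD.
Qed.

End Modulus.

Lemma geometric_small {R : realType} (q c e : R) : 0 <= q < 1 -> 0 <= c ->
  0 < e -> exists n, c * q ^+ n < e.
Proof.
move=> /andP[q0 q1] c0 e0; have q1' : `|q| < 1 by rewrite ger0_norm.
have d0 : 0 < e / (c + 1) by rewrite divr_gt0// ltr_wpDl.
have /cvgrPdist_lt/(_ _ d0)[n _ /(_ n (leqnn n))] := cvg_expr q1'.
rewrite /= sub0r normrN normrX (ger0_norm q0) => qn; exists n.
apply: le_lt_trans (_ : (c + 1) * q ^+ n < _).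
  by rewrite ler_wpM2r ?exprn_ge0// lerDl.
by rewrite mulrC -ltr_pdivlMr// ltr_wpDl.
Qed.

(** Completeness in the form used below: a sequence whose tails lie in balls of
    vanishing radii converges to a point of all these balls. *)
Lemma cvg_radii {R : realType} {V : completeNormedModType R[i]}
    (x : nat -> V) (r : nat -> R) :
  (forall n m, (n <= m)%N -> rnorm (x m - x n) <= r n) ->
  (forall e : R, 0 < e -> exists n, r n < e) ->
  exists l, forall n, rnorm (l - x n) <= r n.
Proof.
move=> xr r0.
have dec (e : R[i]) : 0 < e -> exists2 d : R, 0 < d & (d%:C = e :> R[i]).
  move=> e0; exists (complex.Re e); last by rewrite RRe_real ?gtr0_real.
  by rewrite -(ltcR 0) RRe_real ?gtr0_real.
have : cvg (x @ \oo).
  apply: cauchy_cvg; apply: cauchy_exP => _ /dec[d d0 <-].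
  have [n rn] := r0 d d0; exists (x n), n => // m /= nm.
  rewrite -ball_normE /ball_/= normE ltcR rdistC.
  exact: le_lt_trans (xr _ _ nm) rn.
move=> /cvg_ex[l xl]; exists l => n; apply/ler_addgt0Pr => d d0.
have dC : 0 < d%:C by rewrite (ltcR 0).
have /cvgrPdist_lt/(_ _ dC)[N _ /(_ (maxn N n) (leq_maxl _ _))] := xl.
rewrite /= normE ltcR => lx.
rewrite -(subrK (x (maxn N n)) l) -addrA (le_trans (rnormD _ _))//.
by rewrite [leRHS]addrC lerD ?xr ?leq_maxr// ltW.
Qed.

(** * Uniform boundedness *)

(** If no uniform bound exists, then every ball contains a smaller one on which
    some [f] in [F] exceeds a prescribed [n].  Indeed some [f v] is larger than
    [n + 1] for a vector [v] of norm half the radius, so [f] is larger than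
    [n + 1] at the centre plus or minus [v], and it stays larger than [n] nearby
    since [f] itself is bounded.  The common point of such nested balls violates
    the pointwise bound. *)
Theorem uniform_boundedness {R : realType} (V : completeNormedModType R[i])
    (F : set (V -> R[i])) :
  (forall f, F f -> scalar f /\
    exists M : R, forall x, modulus (f x) <= M * rnorm x) ->
  (forall x, exists M : R, forall f, F f -> modulus (f x) <= M) ->
  exists2 M : R, 0 < M & forall f x, F f -> modulus (f x) <= M * rnorm x.
Proof.
move=> linF ptF; apply: contrapT => unbF.
have big (N : R) : 0 < N -> exists f x, F f /\ N * rnorm x < modulus (f x).
  move=> N0; apply: contrapT => hN; apply: unbF; exists N => // f x Ff.
  by rewrite leNgt; apply/negP => Nfx; apply: hN; exists f, x.
(* Balls are coded as pairs of a centre and a radius. *)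
pose good (n : nat) (b b' : V * R) := [/\ 0 < b'.2, b'.2 <= b.2 / 2,
  rnorm (b'.1 - b.1) <= b.2 / 2 &
  exists2 f, F f & forall x, rnorm (x - b'.1) <= b'.2 -> n%:R < modulus (f x)].
have step (a : nat * (V * R)) : exists b', 0 < a.2.2 -> good a.1 a.2 b'.
  move: a => [n [y r]] /=; have [r0|] := ltP 0 r; last by exists (y, r).
  have N0 : 0 < (n%:R + 1) / (r / 2) by rewrite !divr_gt0// ltr_wpDl.
  have [f [u [Ff fu]]] := big _ N0.
  have [linf [K Kf]] := linF f Ff.
  pose k := Num.max K 1; have k0 : 0 < k by rewrite lt_max ltr01 orbT.
  have fD a b : f (a + b) = f a + f b by rewrite -{1}[a]scale1r linf mul1r.
  have f0 : f 0 = 0 by apply: (addrI (f 0)); rewrite -fD !addr0.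
  have fZ c a : f (c *: a) = c * f a by rewrite -[c *: a]addr0 linf f0 addr0.
  have fN a : f (- a) = - f a by rewrite -scaleN1r fZ mulN1r.
  have u0 : 0 < rnorm u.
    rewrite lt_neqAle rnorm_ge0 andbT eq_sym; apply/eqP => /rnorm_eq0 u0.
    by move: fu; rewrite u0 f0 rnorm0 modulus0 mulr0 ltxx.
  pose v := (r / 2 / rnorm u)%:C *: u.
  have vr : rnorm v = r / 2.
    by rewrite rnormZ modulus_real ?divfK ?gt_eqF// !divr_ge0 ?ltW.
  have fv : n%:R + 1 < modulus (f v).
    rewrite fZ modulusM modulus_real; last by rewrite !divr_ge0 ?ltW.
    by rewrite -mulrA mulrC -ltr_pdivrMr ?divr_gt0// ltr_pdivlMl// mulrC.
  (* [f v] is half of [f (y + v) - f (y - v)], so it is dominated at one of the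
     two points [y + v] and [y - v]. *)
  have [w wr fw] : exists2 w, rnorm (w - y) = r / 2 & n%:R + 1 < modulus (f w).
    have [|h1] := ltP (n%:R + 1) (modulus (f (y + v))).
      by exists (y + v) => //; rewrite addrC addKr.
    exists (y - v); first by rewrite addrC addKr rnormN.
    have : modulus (f v + f v) <= modulus (f (y + v)) + modulus (f (y - v)).
      rewrite -fD (_ : v + v = (y + v) - (y - v)); last first.
        by rewrite opprB [RHS]addrC addrA subrK.
      by rewrite fD fN (le_trans (modulusD _ _))// lerD2l /modulus normrN.
    have -> : modulus (f v + f v) = 2 * modulus (f v).
      rewrite (_ : f v + f v = 2%:C * f v); last first.
        by rewrite rmorph_nat mulr_natl mulr2n.
      by rewrite modulusM modulus_real.
    lra.
  exists (w, Num.min (r / 2) k^-1) => _; split => /=.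
  - by rewrite lt_min !(divr_gt0, invr_gt0).
  - by rewrite ge_min lexx.
  - by rewrite wr.
  exists f => // x; rewrite le_min => /andP[_ xw].
  have : modulus (f w) <= modulus (f x) + 1.
    rewrite -(subrK x w) fD [leRHS]addrC (le_trans (modulusD _ _))// lerD2r.
    rewrite (le_trans (Kf _))// rdistC.
    rewrite (le_trans (_ : _ <= k * rnorm (x - w)))//.
      by rewrite ler_wpM2r ?rnorm_ge0// le_max lexx.
    by rewrite -ler_pdivlMl// mulr1.
  lra.
have [next nextP] := choice step.
pose fix b n : V * R := if n is p.+1 then next (p, b p) else (0, 1).
have b0 n : 0 < (b n).2.
  by elim: n => [|n IH]; [exact: ltr01|have [] := nextP (n, b n) IH].
have bn n := nextP (n, b n) (b0 n).
have b2 n : (b n).2 <= 1 * 2^-1 ^+ n.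
  elim: n => [|n IH]; first by rewrite expr0 mulr1.
  have [_ + _ _] := bn n; rewrite exprSr mulrA => /le_trans; apply.
  by rewrite ler_wpM2r// invr_ge0.
have [l lb] : exists l, forall n, rnorm (l - (b n).1) <= (b n).2.
  apply: (@cvg_radii _ _ (fun n => (b n).1)).
    move=> n m /subnK<-; move: (m - n)%N => k; elim: k n => [|k IH] n.
      by rewrite add0n subrr rnorm0 ltW.
    have [_ bl bd _] := bn n.
    have := IH n.+1; rewrite addnS -addSn => bk.
    rewrite -(subrK (b n.+1).1 (b (k.+1 + n)%N).1) -addrA.
    apply: le_trans (rnormD _ _) _.
    by rewrite [leRHS](splitr (b n).2) lerD// (le_trans bk).
  move=> e e0; have [|n ?] := @geometric_small _ 2^-1 1 e _ ler01 e0.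
    by rewrite invr_ge0 ler0n invf_lt1// ltr1n.
  by exists n; exact: le_lt_trans (b2 n) _.
have [M MF] := ptF l.
have [n Mn] : exists n : nat, M <= n%:R.
  exists (Num.bound `|M|); rewrite (le_trans (ler_norm _))// ltW//.
  by rewrite archi_boundP.
have [_ _ _ [f Ff /(_ l (lb n.+1))]] := bn n.
by apply/negP; rewrite -leNgt (le_trans (MF _ Ff)).
Qed.

(** * Real-valued norms *)

(** * Characters *)

Section BanachAlgebra.
Context {K : numFieldType} {A : comBanachAlgType K}.
Implicit Types x y z : A.

Lemma bmulDr x y z : x ** (y + z) = x ** y + x ** z.
Proof. by rewrite !(bmulC x) bmulDl. Qed.

Lemma bmulNr x y : x ** (- y) = - (x ** y).
Proof. by rewrite !(bmulC x) -scaleN1r bmulZl scaleN1r. Qed.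

Lemma bmulBr x y z : x ** (y - z) = x ** y - x ** z.
Proof. by rewrite bmulDr bmulNr. Qed.

Lemma bmulx0 x : x ** 0 = 0.
Proof. by apply: (addrI (x ** 0)); rewrite -bmulDr !addr0. Qed.

(** If [c] annihilates [A], then [phi c ^+ 2 = phi (c ** c) = 0] for each
    character [phi]. *)
Lemma semisimple_without_order : semisimple A -> without_order A.
Proof.
move=> ssA c c0; suff : radical c by rewrite ssA.
move=> phi; apply/eqP.
by rewrite -[_ == 0]orbb -mulf_eq0 -characterM c0 linear0.
Qed.

Lemma character_ext (phi psi : character A) : phi =1 psi -> phi = psi.
Proof.
case: phi psi => [f fM f0] [g gM g0] /= fg.
have E : f = g.
  case: f g fg {fM f0 gM g0} => [f cf] [g cg] /= /funext E.
  by case: _ / E cg => cg; congr GRing.Linear.Pack;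
     case: cf cg => -[?] [?] [-[?] [?]]; congr GRing.Linear.Class; congr (_ _);
     exact: Prop_irrelevance.
by case: _ / E gM g0 => gM g0; congr Character; exact: Prop_irrelevance.
Qed.

End BanachAlgebra.

Section Pullback.
Context {K : numFieldType} {A A' : comBanachAlgType K}.
Variable h : {linear A' -> A}.
Hypothesis hM : forall x y, h (x ** y) = h x ** h y.

Definition pullback (phi : character A) (phi0 : exists x, phi (h x) != 0) :
  character A'.
Proof.
refine (@Character K A' (phi \o h) _ phi0).
by move=> x y /=; rewrite hM characterM.
Defined.

End Pullback.

(** The topology of the space of characters is that of pointwise convergence. *)
Lemma continuous_to_characters {K : numFieldType} {T : topologicalType}
    {A : comBanachAlgType K} (f : T -> character A) :
  (forall a, continuous (fun t => f t a)) -> continuous f.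
Proof.
move=> fc; apply: continuous_comp_initial => t.
by apply/pointwise_cvgP => a; exact: fc.
Qed.

Section Contractive.
Context {R : realType} {A : comBanachAlgType R[i]}.

Lemma rnormM (x y : A) : rnorm (x ** y) <= rnorm x * rnorm y.
Proof. by rewrite -lecR rmorphM /= -!normE ler_norm_bmul. Qed.

(** If [phi x] exceeded the norm of [x], then, after scaling, [phi z = 1] for
    some [z] of norm less than [1]; the quasi-inverse [y = z + z ** y], which is
    the limit of the geometric series, would satisfy [phi y = 1 + phi y]. *)
Lemma character_contractive (phi : character A) x :
  modulus (phi x) <= rnorm x.
Proof.
rewrite leNgt; apply/negP => xphi.
have phix0 : 0 < modulus (phi x) by rewrite (le_lt_trans (rnorm_ge0 x)).
have phixn0 : phi x != 0.
  by apply: contraTN phix0 => /eqP->; rewrite modulus0 ltxx.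
pose z := (phi x)^-1 *: x.
have phiz : phi z = 1 by rewrite linearZ /= mulVf.
have z1 : rnorm z < 1.
  rewrite rnormZ -(ltr_pM2l phix0) mulrA -modulusM mulfV// mulr1.
  by rewrite (modulus_real ler01) mul1r.
set q := rnorm z in z1; have q0 : 0 <= q := rnorm_ge0 z.
pose y n := iter n (fun y => z + z ** y) 0.
have yB m n : y m.+1 - y n.+1 = z ** (y m - y n).
  by rewrite /y !iterS bmulBr opprD addrACA subrr add0r.
(* The sum of [q ^+ k] over [k > 0], which bounds all the [y m]. *)
pose r := q / (1 - q).
have q1 : 0 < 1 - q by rewrite subr_gt0.
have r0 : 0 <= r by rewrite divr_ge0// ltW.
have rE : r = q + q * r by rewrite /r; field; rewrite gt_eqF.
have [l yl] : exists l, forall n, rnorm (l - y n) <= r * q ^+ n.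
  apply: cvg_radii => [|e e0]; last first.
    by apply: geometric_small => //; rewrite q0.
  elim=> [|n IH] [|m] // nm.
  - by rewrite subrr rnorm0 mulr1.
  - rewrite subr0 mulr1; elim: m {nm} => [|m IH].
      by rewrite /y /= bmulx0 addr0 rE lerDl mulr_ge0.
    rewrite [y _]/(z + z ** y m.+1) (le_trans (rnormD _ _))// rE lerD2l.
    by rewrite (le_trans (rnormM _ _))// ler_wpM2l.
  - by rewrite yB (le_trans (rnormM _ _))// exprS mulrCA ler_wpM2l// IH.
suff : l = z + z ** l.
  move/(congr1 phi)/eqP; rewrite linearD /= characterM phiz mul1r eq_sym.
  by rewrite -subr_eq0 addrK oner_eq0.
apply/eqP; rewrite -subr_eq0; apply/eqP/rnorm_eq0/le_anti.
rewrite rnorm_ge0 andbT.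
apply/ler_addgt0Pr => e e0; rewrite add0r.
have [||n] := @geometric_small R q (r + r) e _ _ e0; rewrite ?q0 ?addr_ge0//.
move=> /ltW; apply: le_trans.
rewrite (_ : l - _ = (l - y n.+1) + z ** (y n - l)); last first.
  by rewrite bmulBr /y iterS !opprD !addrA subrK.
rewrite (le_trans (rnormD _ _))// mulrDl lerD//.
  by rewrite (le_trans (yl _))// exprS ler_wpM2l// ler_piMl ?exprn_ge0// ltW.
rewrite (le_trans (rnormM _ _))// rdistC.
by rewrite (le_trans _ (yl n))// ler_piMl ?rnorm_ge0// ltW.
Qed.

End Contractive.

(** * Real-valued norms *)

(** * Dual norms *)

Section DualNorm.
Context {R : realType} {A : comBanachAlgType R[i]}.
Implicit Types (f : A -> R[i]) (r : R).

Lemma dual_norm_ge0 f : (0 <= dual_norm f)%E.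
Proof.
apply: (@le_trans _ _ (modulus (f 0))%:E); first by rewrite lee_fin modulus_ge0.
by apply: ereal_sup_ubound; exists 0 => //=; rewrite normr0.
Qed.

Lemma dual_norm_le f r : 0 <= r -> (forall x, modulus (f x) <= r * rnorm x) ->
  (dual_norm f <= r%:E)%E.
Proof.
move=> r0 fr; apply: ub_ereal_sup => _ [x /= x1 <-]; rewrite lee_fin.
by rewrite (le_trans (fr x))// ler_piMr// -norm_leE.
Qed.

Lemma dual_norm_ler f r : scalar f -> (dual_norm f <= r%:E)%E ->
  forall x, modulus (f x) <= r * rnorm x.
Proof.
move=> linf fr x.
have f0 : f 0 = 0 by have := linf (-1) 0 0; rewrite scaler0 addr0 mulN1r addNr.
have [->|x0] := eqVneq x 0; first by rewrite f0 modulus0 rnorm0 mulr0.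
have nx0 : 0 < rnorm x.
  rewrite lt_neqAle rnorm_ge0 andbT eq_sym.
  by apply: contra_neq x0; exact: rnorm_eq0.
have nV0 : 0 <= (rnorm x)^-1 by rewrite invr_ge0 ltW.
rewrite -ler_pdivrMr// -lee_fin; apply: le_trans fr.
apply: ereal_sup_ubound; exists ((rnorm x)^-1%:C *: x).
  by rewrite /= -[1]/(1%:C) norm_leE rnormZ modulus_real// mulVf// gt_eqF.
have := linf (rnorm x)^-1%:C x 0; rewrite addr0 f0 addr0 => ->.
by rewrite modulusM modulus_real// mulrC.
Qed.

End DualNorm.

(** * BSE functions and multipliers under retracts and quotients *)

Section Combinations.
Context {R : realType} {A : comBanachAlgType R[i]}.

Lemma character_comb_scalar n (c : 'I_n -> R[i]) (phi : 'I_n -> character A) :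
  scalar (fun x => \sum_(j < n) c j * phi j x).
Proof.
move=> k x y; rewrite mulr_sumr -big_split /=; apply: eq_bigr => j _.
by rewrite linearP mulrDr mulrCA.
Qed.

Lemma character_comb_bounded n (c : 'I_n -> R[i]) (phi : 'I_n -> character A) :
  forall x, modulus (\sum_(j < n) c j * phi j x) <=
    (\sum_(j < n) modulus (c j)) * rnorm x.
Proof.
move=> x; rewrite (le_trans (modulus_sum _))// mulr_suml ler_sum// => j _.
by rewrite modulusM ler_wpM2l ?modulus_ge0 ?character_contractive.
Qed.

(** The identity is a multiplier with transform [1].  The resulting inequality
    [|sum_j c_j| <= M |sum_j c_j phi_j|] amounts to a bounded weak approximate
    identity in [A]. *)
Lemma identity_C_BSE : BSE_algebra A -> C_BSE A (cst 1).
Proof.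
move=> [_ ->]; exists idfun; first by [].
by split=> [|phi c] /=; [exact: cst_continuous|rewrite mul1r].
Qed.

End Combinations.

Section Retract.
Context {R : realType} {A A' : comBanachAlgType R[i]}.

(** Restriction along [i] carries [s] to a function on the characters of [A]
    that is BSE with the same constant, because [i] is contractive.  If [T] is a
    multiplier of [A] inducing it, then [p \o T \o i] induces [s]. *)
Lemma C_BSE_sub_retract (i : {linear A' -> A}) (p : {linear A -> A'})
    (iM : forall x y, i (x ** y) = i x ** i y)
    (pM : forall x y, p (x ** y) = p x ** p y) :
  cancel i p -> (forall x, rnorm (i x) <= rnorm x) ->
  (forall phi : character A, exists x, phi (i x) != 0) ->
  C_BSE A `<=` multiplier_transforms A ->
  C_BSE A' `<=` multiplier_transforms A'.
Proof.
move=> iK i1 inz bseA s [sc [M M0 sM]].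
pose res phi := pullback iM (inz phi).
have [T MT [_ TE]] : multiplier_transforms A (s \o res).
  apply: bseA; split.
    move=> phi; apply: continuous_comp; last exact: sc.
    apply: continuous_to_characters => a psi.
    exact: (@character_eval_continuous _ A (i a) psi).
  exists M => // n c phi; apply: (le_trans (sM n c (res \o phi))).
  rewrite lee_pmul2l// ?lte_fin//; apply: ub_ereal_sup => _ [x /= x1 <-].
  apply: ereal_sup_ubound; exists (i x) => //=.
  by move: x1; rewrite -[1]/(1%:C) !norm_leE; apply: le_trans.
have pnz (psi : character A') : exists x, psi (p x) != 0.
  by have [x x0] := character_neq0 psi; exists (i x); rewrite iK.
exists (p \o T \o i); first by move=> b c /=; rewrite -{1}(iK c) -pM MT pM iK.
split=> // psi c; have := TE (pullback pM (pnz psi)) (i c).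
rewrite /= iK => ->; congr (s _ * _); apply: character_ext => x /=.
by rewrite iK.
Qed.

(** Uniform boundedness over the combinations [f] of characters of norm at most
    [1] replaces the continuity of [p] and of the multiplier [S]: each
    [f \o S \o p] is a combination of characters of [A], with coefficients
    multiplied by [s]. *)
Lemma multiplier_transforms_sub_quotient (p : {linear A -> A'})
    (pM : forall x y, p (x ** y) = p x ** p y) :
  (forall y, exists x, p x = y) ->
  C_BSE A (cst 1) ->
  multiplier_transforms A' `<=` C_BSE A'.
Proof.
move=> psurj [_ [M M0 idM]] s [S MS [sc SE]]; split => //.
have pnz (psi : character A') : exists x, psi (p x) != 0.
  have [y y0] := character_neq0 psi; have [x xy] := psurj y.
  by exists x; rewrite xy.
pose lift psi := pullback pM (pnz psi).
pose f n (c : 'I_n -> R[i]) (psi : 'I_n -> character A') y :=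
  \sum_(j < n) c j * psi j y.
have fS n c (psi : 'I_n -> character A') x :
    \sum_(j < n) (c j * s (psi j)) * lift (psi j) x = f n c psi (S (p x)).
  by apply: eq_bigr => j _; rewrite SE mulrA.
have [K K0 fK] : exists2 K : R, 0 < K & forall n c psi,
    (forall y, modulus (f n c psi y) <= rnorm y) ->
    forall x, modulus (f n c psi (S (p x))) <= K * rnorm x.
  pose F := [set g : A -> R[i] | exists n c psi,
    (forall y, modulus (f n c psi y) <= rnorm y) /\
    g = fun x => f n c psi (S (p x))].
  have [g [n [c [psi [_ ->]]]]|x|K K0 FK] := @uniform_boundedness R A F.
  - split=> [k x y|]; first rewrite !linearP.
      exact: (character_comb_scalar c psi).
    exists (\sum_(j < n) modulus (c j * s (psi j))) => x.
    by rewrite -fS; exact: character_comb_bounded.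
  - by exists (rnorm (S (p x))) => _ [n [c [psi [fle ->]]]]; exact: fle.
  exists K => // n c psi fle x; apply: (FK (fun z => f n c psi (S (p z)))).
  by exists n, c, psi.
exists (M * K) => [|n c psi]; first by rewrite mulr_gt0.
have sumM (r : R) : 0 <= r ->
    (forall x, modulus (f n c psi (S (p x))) <= r * rnorm x) ->
    modulus (\sum_(j < n) c j * s (psi j)) <= M * r.
  move=> r0 fr; rewrite -lee_fin.
  have := idM n (fun j => c j * s (psi j)) (lift \o psi).
  under eq_bigr do rewrite /= mulr1.
  move/le_trans; apply; rewrite EFinM lee_pmul2l// ?lte_fin//.
  by apply: dual_norm_le => // x; rewrite fS.
have := @dual_norm_ge0 _ _ (f n c psi).
have := fun r => @dual_norm_ler _ _ (f n c psi) r (character_comb_scalar c psi).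
rewrite -/(f n c psi).
(* A norm [r = 0] is treated apart, since [f] is scaled by [r^-1] below. *)
case: (dual_norm _) => [r| |] // fr; last first.
  by move=> _; rewrite gt0_muley ?lte_fin ?mulr_gt0// leey.
rewrite lee_fin le_eqVlt => /predU1P[r0|r0].
  rewrite -r0 mule0 lee_fin -[leRHS](mulr0 M); apply: sumM => // x.
  by rewrite mul0r -(mul0r (rnorm (S (p x)))) fr// -r0 lexx.
rewrite -EFinM lee_fin -mulrA; apply: sumM => [|x].
  by rewrite mulr_ge0 ?ltW.
have rV0 : 0 <= r^-1 by rewrite invr_ge0 ltW.
pose c' j := r^-1%:C * c j.
have fc' y : f n c' psi y = r^-1%:C * f n c psi y.
  by rewrite /f mulr_sumr; apply: eq_bigr => j _; rewrite mulrA.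
have := fK n c' psi _ x; rewrite fc' modulusM modulus_real// mulrC.
rewrite ler_pdivrMr// mulrAC; apply => y.
rewrite fc' modulusM modulus_real// mulrC ler_pdivrMr// mulrC.
exact: fr (lexx _) y.
Qed.

End Retract.

(** * Semidirect products *)

Section SemidirectProduct.
Context {K : numFieldType} {A : comBanachAlgType K}.
Variables B I : closed_subalgebra A.

(** The projection along [I] is multiplicative because [x ** y - p x ** p y] is
    [(x - p x) ** y + p x ** (y - p y)], an element of the ideal [I]. *)
Lemma semidirect_projection : semidirect_product B I ->
  exists p : {linear A -> subalg B},
    (forall x y, p (x ** y) = p x ** p y) /\ cancel val p.
Proof.
move=> [idI BI BI0].
have IN x : (I : set A) x -> (I : set A) (- x).
  by rewrite -scaleN1r; exact: subalgZ.
have dec x : exists b : subalg B, (I : set A) (x - val b).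
  have : [set b + a | b in (B : set A) & a in (I : set A)] x by rewrite BI.
  case=> b Bb [a Ia <-]; exists (Subalg (mem_set Bb)).
  by rewrite /= addrAC subrr add0r.
have [p pP] := choice dec.
have puniq x b : (I : set A) (x - val b) -> p x = b.
  move=> xb; apply/val_inj/eqP; rewrite -subr_eq0; apply/eqP.
  suff : (B `&` I : set A) (val (p x) - val b) by rewrite BI0.
  split; first by have := set_mem (valP (p x - b)).
  rewrite (_ : _ - _ = (x - val b) - (x - val (p x))); last first.
    by rewrite opprB [RHS]addrC addrA subrK.
  by apply: subalgD => //; exact: IN.
have linp : linear p.
  move=> k x y; apply: puniq; rewrite linearP addrACA -scalerDr /=.
  by apply: subalgD => //; exact: subalgZ.
pose pl : {linear A -> subalg B} :=
  HB.pack p (GRing.isLinear.Build K A (subalg B) *:%R p linp).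
exists pl; split=> [x y|b]; apply: puniq; last by rewrite subrr; exact: subalg0.
rewrite (_ : _ - _ = (x - val (p x)) ** y + val (p x) ** (y - val (p y))).
  apply: subalgD; first by have [] := idI y _ (pP x).
  by have [] := idI (val (p x)) _ (pP y).
by rewrite bmulBr !(bmulC _ y) bmulBr addrA subrK.
Qed.

End SemidirectProduct.

(** A character is contractive, so one vanishing on [B] vanishes on the closed
    span of [I ** B], that is on [I], hence everywhere. *)
Lemma character_restriction_neq0 {R : realType} {A : comBanachAlgType R[i]}
    (B I : closed_subalgebra A) (phi : character A) :
  semidirect_product B I -> closed_span_mul I B = I ->
  exists b : subalg B, phi (val b) != 0.
Proof.
move=> [_ BI _] IBI; apply: contrapT => phiB.
have phiB0 b : (B : set A) b -> phi b = 0.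
  move=> Bb; apply/eqP/negPn/negP => b0; apply: phiB.
  by exists (Subalg (mem_set Bb)).
have phiI0 a : (I : set A) a -> phi a = 0.
  rewrite -IBI => clIB; apply: modulus_eq0; apply: le_anti.
  rewrite modulus_ge0 andbT; apply/ler_addgt0Pr => e e0; rewrite add0r.
  have eC : 0 < e%:C by rewrite (ltcR 0).
  have [_ [[n [k [v [vIB ->]]]]]] := clIB _ (nbhsx_ballx a _ eC).
  rewrite -ball_normE /ball_/= normE ltcR => /ltW; apply: le_trans.
  apply: le_trans (character_contractive phi _).
  rewrite linearB raddf_sum /= big1 ?subr0// => j _.
  rewrite linearZ /=; have [x _ [y By <-]] := vIB j.
  by rewrite characterM (phiB0 y)// !mulr0.
have [x] := character_neq0 phi; apply/negP; rewrite negbK.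
have : [set b + a | b in (B : set A) & a in (I : set A)] x by rewrite BI.
by case=> b Bb [a Ia <-]; rewrite linearD /= phiB0// phiI0// addr0.
Qed.

Theorem proposition3p2 (R : realType) (A : comBanachAlgType R[i])
    (B I : closed_subalgebra A) :
  semidirect_product B I ->
  semisimple (subalg B) ->
  semisimple (subalg I) ->
  closed_span_mul I B = I ->
  BSE_algebra A ->
  BSE_algebra (subalg B).
Proof.
move=> BI ssB _ IBI bseA; split; first exact: semisimple_without_order.
have [p [pM pK]] := semidirect_projection BI.
apply/seteqP; split.
  refine (@C_BSE_sub_retract _ A (subalg B)
    (val : {linear subalg B -> A}) p _ pM pK _ _ _) => //.
    by move=> phi; exact: character_restriction_neq0 BI IBI.
  by have [_ ->] := bseA.
apply: (@multiplier_transforms_sub_quotient _ _ _ p) => //.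
  by move=> b; exists (val b); exact: pK.
exact: identity_C_BSE.
Qed.
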